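(* Let $m$, $n$ and $q$ be positive integers such that $n$ is odd and $q$ is even. Then \[ \sum_{k = 1}^\infty \frac{F_{2nk+mnq}\prod_{j=1}^{m-1}L_{nk+jnq}^2}{\prod_{j=0}^{m} F_{nk+jnq}^2} = \frac{1}{4F_{mnq}}\sum_{k=1}^{q}\left[(-1)^k\prod_{j=0}^{m-1}\frac{L_{nk+jnq}^2}{F_{nk+jnq}^2}\right]. \]
   Context: The Fibonacci numbers are defined by $F_0=0$, $F_1=1$, $F_n=F_{n-1}+F_{n-2}$, and the Lucas numbers by $L_0=2$, $L_1=1$, $L_n=L_{n-1}+L_{n-2}$. Infinite sums are limits of partial sums. Empty products equal $1$ (in particular $\prod_{j=1}^{0}=1$). *)

(* Defs.v *)
From mathcomp Require Import all_boot.

Set Implicit Arguments.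
Unset Strict Implicit.
Unset Printing Implicit Defensive.

Fixpoint fib (n : nat) : nat :=
  match n with
  | 0 => 0
  | n'.+1 => match n' with
             | 0 => 1
             | n''.+1 => fib n' + fib n''
             end
  end.

Fixpoint lucas (n : nat) : nat :=
  match n with
  | 0 => 2
  | n'.+1 => match n' with
             | 0 => 1
             | n''.+1 => lucas n' + lucas n''
             end
  end.

(* Main.v *)
Require Import Defs.
From mathcomp Require Import all_boot all_order all_algebra.
From mathcomp Require Import all_classical all_reals all_analysis.
From mathcomp Require Import ring zify.

Import Order.TTheory GRing.Theory Num.Theory.
Import numFieldNormedType.Exports.
Local Open Scope classical_set_scope.
Local Open Scope ring_scope.

(** Put [b k = \prod_(0 <= j < m) L_(nk+jnq)^2 / F_(nk+jnq)^2].  The products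
    defining [b k] and [b (k + q)] overlap except for one factor each, and
    [L_a^2 F_b^2 - L_b^2 F_a^2 = 4 (-1)^a F_(b-a) F_(a+b)], so the [k]-th term
    of the series is [(-1)^k (b k - b (k + q)) / (4 F_mnq)].  As [q] is even
    this telescopes with step [q]; the remainder is an alternating sum of [q]
    consecutive values of [b], which tends to 0 because [b] converges (to
    [5^m]). *)

Lemma fibSS k : fib k.+2 = (fib k.+1 + fib k)%N.
Proof. by []. Qed.

Lemma lucasSS k : lucas k.+2 = (lucas k.+1 + lucas k)%N.
Proof. by []. Qed.

(** The two halves are proved together because each induction step uses both. They make [k -> k.+1]
    a linear map on the pair [(fib k, lucas k)], so the inductions below need only one step back. *)
Lemma fib_lucasS k :
  (2 * fib k.+1 = lucas k + fib k)%N /\ (2 * lucas k.+1 = lucas k + 5 * fib k)%N.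
Proof. by elim: k => // k [IHf IHl]; rewrite fibSS lucasSS; lia. Qed.

Lemma fib_gt0 k : (0 < k)%N -> (0 < fib k)%N.
Proof.
case: k => // k _; elim: k => // k IH.
by rewrite fibSS addn_gt0 IH.
Qed.

Lemma leq_fibS k : (k <= (fib k).+1)%N.
Proof.
elim: k => // -[|[|k]] // IH; rewrite fibSS.
by have := @fib_gt0 k.+1 isT; lia.
Qed.

Section FibonacciLucas.
Variable R : numFieldType.
Implicit Types a d k : nat.

Let F k : R := (fib k)%:R.
Let L k : R := (lucas k)%:R.

Lemma natr_fibS k : F k.+1 = (L k + F k) / 2.
Proof.
have [h _] := fib_lucasS k.
by rewrite /F /L -natrD -h natrM mulrC mulKf ?pnatr_eq0.
Qed.

Lemma natr_lucasS k : L k.+1 = (L k + 5 * F k) / 2.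
Proof.
have [_ h] := fib_lucasS k.
by rewrite /F /L -natrM -natrD -h natrM mulrC mulKf ?pnatr_eq0.
Qed.

(** With [phi] the golden ratio, [L k + F k * sqrt 5 = 2 * phi ^ k]; since [phi] has norm [-1],
    taking norms gives the identity. *)
Lemma natr_lucas_sqr k : L k ^+ 2 = 5 * F k ^+ 2 + 4 * (-1) ^+ k.
Proof.
elim: k => [|k IH]; first by rewrite /L /F /=; ring.
rewrite natr_fibS natr_lucasS [(-1) ^+ k.+1]exprS.
have -> : (-1) ^+ k = (L k ^+ 2 - 5 * F k ^+ 2) / 4 by rewrite IH; field.
by field.
Qed.

(** These are the [sqrt 5] part and the rational part of [phi ^ (a + d) = phi ^ a * phi ^ d]. *)
Lemma natr_fib_lucasD a d :
  2 * F (a + d)%N = L a * F d + L d * F a /\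
  2 * L (a + d)%N = L a * L d + 5 * F a * F d.
Proof.
elim: d => [|d [IHf IHl]]; first by rewrite addn0 /F /L /=; split; ring.
rewrite addnS !natr_fibS !natr_lucasS; split.
  transitivity ((2 * L (a + d)%N + 2 * F (a + d)%N) / 2); first by field.
  by rewrite IHf IHl; field.
transitivity ((2 * L (a + d)%N + 5 * (2 * F (a + d)%N)) / 2); first by field.
by rewrite IHf IHl; field.
Qed.

Lemma lucas_fib_cross a d :
  L a ^+ 2 * F (a + d)%N ^+ 2 - L (a + d)%N ^+ 2 * F a ^+ 2 =
  4 * (-1) ^+ a * F d * F (2 * a + d)%N.
Proof.
have [hF hL] := natr_fib_lucasD a d.
have -> : (2 * a + d = a + (a + d))%N by lia.
have [h2F _] := natr_fib_lucasD a (a + d).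
have -> : F (a + (a + d))%N = (L a * F (a + d)%N + L (a + d)%N * F a) / 2.
  by rewrite -h2F; field.
have -> : F (a + d)%N = (L a * F d + L d * F a) / 2 by rewrite -hF; field.
have -> : L (a + d)%N = (L a * L d + 5 * F a * F d) / 2 by rewrite -hL; field.
(* Eliminating the sign leaves a polynomial identity in [L a], [F a], [L d], [F d]. *)
have -> : 4 * (-1) ^+ a = L a ^+ 2 - 5 * F a ^+ 2.
  by rewrite natr_lucas_sqr; ring.
by field.
Qed.

End FibonacciLucas.

Lemma cvg_fib : fib k @[k --> \oo] --> \oo.
Proof.
apply/cvgnyPge => A; near=> k.
have : (A.+1 <= k)%N by near: k; exists A.+1.
by have := leq_fibS k; lia.
Unshelve. all: by end_near. Qed.

Lemma cvg_sign_mul0 (R : realType) (u : nat -> R) :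
  u @ \oo --> 0 -> (-1) ^+ k * u k @[k --> \oo] --> 0.
Proof.
move=> u0; apply/norm_cvg0P.
under eq_cvg do rewrite normrMsign.
by apply/norm_cvg0P.
Qed.

Lemma cvg_lucas_fib_ratio (R : realType) :
  (lucas k)%:R ^+ 2 / (fib k)%:R ^+ 2 @[k --> \oo] --> (5 : R).
Proof.
have F0 : ((fib k)%:R : R)^-1 @[k --> \oo] --> (0 : R).
  apply/gtr0_cvgV0; last by apply/cvgrnyP; exact: cvg_fib.
  near=> k; rewrite ltr0n; apply: fib_gt0.
  by near: k; exists 1%N.
have S0 : (-1) ^+ k / ((fib k)%:R : R) @[k --> \oo] --> (0 : R).
  exact: cvg_sign_mul0 F0.
(* Dividing [natr_lucas_sqr] by [F_k^2] gives the ratio as 5 plus a product of two null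
   sequences. *)
have H : 5 + 4 * (((-1) ^+ k / ((fib k)%:R : R)) * (fib k)%:R^-1)
    @[k --> \oo] --> (5 + 4 * (0 * 0) : R).
  by apply: cvgD; [exact: cvg_cst|apply: cvgM; [exact: cvg_cst|exact: cvgM]].
rewrite !mulr0 addr0 in H; apply: cvg_trans H; apply: near_eq_cvg; near=> k.
rewrite natr_lucas_sqr; field.
rewrite pnatr_eq0 -lt0n; apply: fib_gt0.
by near: k; exists 1%N.
Unshelve. all: by end_near. Qed.

(** After moving the negative terms across, both sides are the sum of [c] over [1..N+q], cut at [N]
    or at [q]; no order between [N] and [q] is assumed. *)
Lemma sumr_shift_diff (V : zmodType) (c : nat -> V) q N :
  \sum_(1 <= k < N.+1) (c k - c (k + q)%N) =
  \sum_(1 <= k < q.+1) c k - \sum_(1 <= k < q.+1) c (N + k)%N.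
Proof.
have shift p r : \sum_(1 <= k < r.+1) c (k + p)%N = \sum_(p.+1 <= k < (p + r).+1) c k.
  by rewrite -[p.+1]add1n big_addn subSn ?leq_addr// addKn.
rewrite sumrB shift; under [X in _ = _ - X]eq_bigr do rewrite addnC.
rewrite shift; apply/eqP; rewrite subr_eq addrAC eq_sym subr_eq eq_sym; apply/eqP.
by rewrite -!big_cat_nat ?ltnS ?leq_addr//= addnC.
Qed.

Lemma sumr_sign_even (R : pzRingType) q :
  ~~ odd q -> \sum_(1 <= k < q.+1) (-1) ^+ k = 0 :> R.
Proof.
move=> q_even; rewrite -(even_halfK q_even); elim: q./2 => [|r IH].
  by rewrite big_geq.
by rewrite doubleS 2?big_nat_recr//= IH add0r (exprS _ _.+1) mulN1r subrr.
Qed.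

(** Evenness of [q] enters twice: it gives [(-1)^(k+q) = (-1)^k], so the sum telescopes, and it
    makes the signs in the remainder cancel in the limit. *)
Lemma cvg_sum_sign_shift (R : realType) (b : nat -> R) (l : R) q :
  ~~ odd q -> b @ \oo --> l ->
  \sum_(1 <= k < N.+1) (-1) ^+ k * (b k - b (k + q)%N) @[N --> \oo] -->
  \sum_(1 <= k < q.+1) (-1) ^+ k * b k.
Proof.
move=> q_even bl; pose c k := (-1) ^+ k * b k.
(* The remainder with its oscillating factor [(-1)^N] removed, so that it converges term by term. *)
pose T N := \sum_(1 <= k < q.+1) (-1) ^+ k * b (N + k)%N.
have T0 : T N @[N --> \oo] --> (0 : R).
  have -> : 0 = \sum_(1 <= k < q.+1) (-1) ^+ k * l.
    by rewrite -mulr_suml sumr_sign_even ?mul0r.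
  apply: (@cvg_big R^o) => [|k _]; first exact: add_continuous.
  apply: cvgM; first exact: cvg_cst.
  by rewrite (cvg_shiftn k b).
have ST0 : (-1) ^+ N * T N @[N --> \oo] --> (0 : R).
  exact: cvg_sign_mul0 T0.
have SE N : \sum_(1 <= k < N.+1) (-1) ^+ k * (b k - b (k + q)%N) =
    \sum_(1 <= k < q.+1) c k - (-1) ^+ N * T N.
  rewrite /T mulr_sumr; under [X in _ = _ - X]eq_bigr do rewrite mulrA -exprD.
  rewrite -(@sumr_shift_diff _ c); apply: eq_bigr => k _.
  by rewrite /c exprD -(signr_odd _ q) (negbTE q_even) mulr1 mulrBr.
rewrite -[X in _ --> X]subr0; under eq_cvg do rewrite SE.
by apply: cvgB ST0; exact: cvg_cst.
Qed.

Theorem theorem2p41 (R : realType) (m n q : nat)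
    (hm : (0 < m)%N) (hn : (0 < n)%N) (hq : (0 < q)%N)
    (n_odd : odd n) (q_even : ~~ odd q) :
  (\sum_(1 <= k < N.+1)
      ((fib (2 * n * k + m * n * q))%:R
         * \prod_(1 <= j < m) (lucas (n * k + j * n * q))%:R ^+ 2)
      / (\prod_(0 <= j < m.+1) (fib (n * k + j * n * q))%:R ^+ 2))
    @[N --> \oo] -->
  (1 / (4 * (fib (m * n * q))%:R)
     * \sum_(1 <= k < q.+1)
         ((-1) ^+ k
            * \prod_(0 <= j < m)
                ((lucas (n * k + j * n * q))%:R ^+ 2
                   / (fib (n * k + j * n * q))%:R ^+ 2)) : R).
Proof.
pose x k : R := (lucas k)%:R ^+ 2 / (fib k)%:R ^+ 2.
pose b k := \prod_(0 <= j < m) x (n * k + j * n * q)%N.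
have b_cvg : b k @[k --> \oo] --> \prod_(0 <= j < m) (5 : R).
  apply: (@cvg_big R^o) => [|j _]; first exact: mul_continuous.
  apply: (@cvg_comp _ _ _ (fun k => n * k + j * n * q)%N x); last first.
    exact: cvg_lucas_fib_ratio.
  exact: cvg_comp (cvg_mulnl _ hn) (cvg_addnr _).
have F_neq0 k : (0 < k)%N -> (fib k)%:R != 0 :> R.
  by move=> k0; rewrite pnatr_eq0 -lt0n fib_gt0.
have term k : (0 < k)%N ->
    (fib (2 * n * k + m * n * q))%:R
         * \prod_(1 <= j < m) (lucas (n * k + j * n * q))%:R ^+ 2
      / \prod_(0 <= j < m.+1) (fib (n * k + j * n * q))%:R ^+ 2
    = 1 / (4 * (fib (m * n * q))%:R) * ((-1) ^+ k * (b k - b (k + q)%N)).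
  move=> k0.
  (* [P] collects the factors shared by [b k] and [b (k + q)]: moving [k] by [q] turns the factor of
     index [j] into that of index [j + 1]. *)
  pose P := \prod_(1 <= j < m) x (n * k + j * n * q)%N.
  have b0 : b k = x (n * k)%N * P by rewrite /b big_ltn// !mul0n addn0.
  have bq : b (k + q)%N = P * x (n * k + m * n * q)%N.
    rewrite -(big_nat_recr _ _ (fun j => x (n * k + j * n * q)%N))//= big_add1 /=.
    by apply: eq_bigr => j _; congr x; rewrite mulnDr mulSn mulnDl; lia.
  have Fk : (fib (n * k))%:R != 0 :> R by rewrite F_neq0 ?muln_gt0 ?hn.
  have Fkm : (fib (n * k + m * n * q))%:R != 0 :> R.
    by rewrite F_neq0 ?addn_gt0 ?muln_gt0 ?hn ?k0.
  have Fm : (fib (m * n * q))%:R != 0 :> R by rewrite F_neq0 ?muln_gt0 ?hm ?hn.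
  have B0 : \prod_(1 <= j < m) (fib (n * k + j * n * q))%:R ^+ 2 != 0 :> R.
    rewrite prodf_seq_neq0; apply/allP => j _ /=.
    by rewrite expf_neq0 ?F_neq0 ?addn_gt0 ?muln_gt0 ?hn ?k0.
  have cross := lucas_fib_cross R (n * k) (m * n * q).
  have sgn : (-1) ^+ (n * k) = (-1) ^+ k :> R.
    by rewrite -signr_odd oddM n_odd signr_odd.
  rewrite sgn mulnA in cross.
  rewrite b0 bq /P /x prodf_div [X in _ / X]big_ltn// [X in _ / (_ * X)]big_nat_recr//=.
  rewrite !mul0n !addn0.
  have s2 : (-1) ^+ k * (-1) ^+ k = 1 :> R by rewrite -exprMn mulN1r opprK expr1n.
  set A := \prod_(1 <= j < m) (lucas _)%:R ^+ 2.
  set B := \prod_(1 <= j < m) (fib _)%:R ^+ 2 in B0 *.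
  set G := (fib (2 * n * k + _))%:R in cross *.
  move: Fk Fkm Fm cross B0 s2.
  set f := (fib (n * k))%:R; set g := (fib (n * k + _))%:R.
  set h := (fib (m * n * q))%:R; set s := (-1) ^+ k.
  set u := (lucas (n * k))%:R; set v := (lucas (n * k + _))%:R.
  move=> f0 g0 h0 cross B0 s2.
  (* Inserting [s * s = 1] exposes the right side of [cross], which is then traded for the
     difference of squares. *)
  transitivity (s * (4 * s * h * G) * A / (4 * h * f ^+ 2 * g ^+ 2 * B)).
    rewrite (_ : s * (4 * s * h * G) = s * s * (4 * h * G)); last by ring.
    by rewrite s2; field; rewrite f0 g0 h0 B0.
  by rewrite -cross; field; rewrite f0 g0 h0 B0.
under eq_cvg => N.
  rewrite (eq_big_nat _ _ (F2 := fun k => 1 / (4 * (fib (m * n * q))%:R) *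
    ((-1) ^+ k * (b k - b (k + q)%N)))); last by move=> k /andP[k0 _]; exact: term.
  rewrite -mulr_sumr.
  over.
by apply: cvgM; [exact: cvg_cst|exact: cvg_sum_sign_shift b_cvg].
Qed.
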